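(* Let $(x,y)$ be a sample, let $m\in\{1,\dots,M\}$, and let $w_1^t,\dots,w_M^t$ be arbitrary values of the auxiliary parameters. With $x_m$, $\Delta h_m^t$, $\nabla\hat h_m^t$ and the fine-tuned network $f_\theta(x,\Delta h_{1:M})$ as defined in the context, consider the auxiliary quadratic loss $$\ell_m(x,y;w_m)=\tfrac12\bigl\| g_{w_m}(x_m)-(\Delta h_m^t-\nabla\hat h_m^t)\bigr\|_2^2,$$ regarded as a function of $w_m$ in which $x_m$ and the target $\Delta h_m^t-\nabla\hat h_m^t$ are held fixed (they do not vary with $w_m$). Then $$\nabla_{w_m}\ell_m(x,y;w_m)\Big|_{w_m=w_m^t}=\nabla_{w_m}\mathcal L\bigl(y,f_\theta(x,\Delta h_{1:M})\bigr)\Big|_{w_m=w_m^t},$$ where on the right-hand side $w_j=w_j^t$ is held fixed for all $j\neq m$ and the loss is regarded as a function of $w_m$ only. This holds for any value of $w_m^t$.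
   Context: All spaces are finite-dimensional real vector spaces. A network has $M$ layers with fixed (frozen) parameters $\theta_1,\dots,\theta_M$; layer $j$ is a map $f_{\theta_j}(\cdot)$. To each layer $j$ is attached an auxiliary model $g_{w_j}(\cdot)$, parameterized by $w_j$, whose input and output spaces are those of $f_{\theta_j}$. $\mathcal L(y,\cdot)$ is a real-valued loss function. The maps $f_{\theta_j}$ (in their input), the maps $(w,z)\mapsto g_w(z)$ for each layer (jointly in parameter and input), and $\mathcal L(y,\cdot)$ are assumed differentiable. Fine-tuned network: given input $x$ and auxiliary parameters $w_1,\dots,w_M$, set $x_1=x$ and, for $j=1,\dots,M$, $$h_j=f_{\theta_j}(x_j),\qquad \Delta h_j=g_{w_j}(x_j),\qquad \hat h_j=h_j+\Delta h_j,\qquad x_{j+1}=\hat h_j$$ (this is the scaling factor $\alpha=1$ in $\hat h_j=h_j+\alpha\,\Delta h_j$). The output of the fine-tuned network is $f_\theta(x,\Delta h_{1:M})=\hat h_M$. In particular, $x_m$ does not depend on $w_m$. Quantities at the parameter values $w_1^t,\dots,w_M^t$: set $x_1=x$ and compute $h_j=f_{\theta_j}(x_j)$, $\Delta h_j=g_{w_j^t}(x_j)$, $\hat h_j=h_j+\Delta h_j$, $x_{j+1}=\hat h_j$ for $j=1,\dots,M$; let $x_m$ and $h_m$ be the resulting hidden input and base hidden representation of layer $m$, and let $\Delta h_m^t=g_{w_m^t}(x_m)$. Let $\Phi_m(u)$ denote the value of the loss $\mathcal L(y,\hat h_M)$ obtained when the representation $\hat h_m$ is set equal to $u$ and the layers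 $j=m+1,\dots,M$ are then computed by $x_j=\hat h_{j-1}$, $\hat h_j=f_{\theta_j}(x_j)+g_{w_j^t}(x_j)$. Then $$\nabla\hat h_m^t=\frac{\partial\mathcal L(y,f_\theta(x,\Delta h_{1:M}^t))}{\partial\hat h_m}\Big|_{\hat h_m=h_m+\Delta h_m^t}:=\nabla\Phi_m\bigl(h_m+\Delta h_m^t\bigr),$$ i.e. the gradient of the loss with respect to $\hat h_m$ computed by back-propagation. $\|\cdot\|_2$ is the Euclidean norm. *)

(* Defs.v *)
From mathcomp Require Import all_boot all_order all_algebra.
From mathcomp Require Import all_classical all_reals all_analysis.

Set Implicit Arguments.
Unset Strict Implicit.
Unset Printing Implicit Defensive.

Import Order.TTheory GRing.Theory Num.Theory.
Import numFieldNormedType.Exports.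

Local Open Scope ring_scope.

(* The library norm on 'rV[R]_n is the sup norm, hence this definition. *)
Definition norm2 {R : realType} {n : nat} (v : 'rV[R]_n) : R :=
  Num.sqrt (\sum_(i < n) v 0 i ^+ 2).

Definition gradient {R : realType} {n : nat} (F : 'rV[R]_n -> R)
    (a : 'rV[R]_n) : 'rV[R]_n :=
  \row_(i < n) 'D_(delta_mx 0 i) F a.

(* Layers are numbered from 0: a network with M layers consists of the layers
   j < M, layer j maps 'rV_(d j) to 'rV_(d j.+1) and its auxiliary parameter is
   in 'rV_(p j).  Families are indexed by nat; an M-layer network only uses
   their members of index j < M. *)
Section Network.
Context {R : realType} {d p : nat -> nat} {Theta : nat -> Type}.

(* State after k steps: the input of layer k, and the output of layer k.-1
   when 0 < k. *)
Fixpoint forward (step : forall j, 'rV[R]_(d j) -> 'rV[R]_(d j.+1))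
    (x : 'rV[R]_(d 0%N)) (k : nat) : 'rV[R]_(d k) :=
  match k with
  | 0%N => x
  | j.+1 => step j (forward step x j)
  end.

Context (f : forall j, Theta j -> 'rV[R]_(d j) -> 'rV[R]_(d j.+1))
  (theta : forall j, Theta j)
  (g : forall j, 'rV[R]_(p j) -> 'rV[R]_(d j) -> 'rV[R]_(d j.+1)).

Definition finetuned_layer (w : forall j, 'rV[R]_(p j)) (j : nat)
    (z : 'rV[R]_(d j)) : 'rV[R]_(d j.+1) :=
  f (theta j) z + g (w j) z.

Definition hidden_input (w : forall j, 'rV[R]_(p j)) (x : 'rV[R]_(d 0%N))
    (j : nat) : 'rV[R]_(d j) :=
  forward (finetuned_layer w) x j.

Definition base_repr (w : forall j, 'rV[R]_(p j)) (x : 'rV[R]_(d 0%N))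
    (j : nat) : 'rV[R]_(d j.+1) :=
  f (theta j) (hidden_input w x j).

Definition delta_repr (w : forall j, 'rV[R]_(p j)) (x : 'rV[R]_(d 0%N))
    (j : nat) : 'rV[R]_(d j.+1) :=
  g (w j) (hidden_input w x j).

Definition finetuned_output (M : nat) (w : forall j, 'rV[R]_(p j))
    (x : 'rV[R]_(d 0%N)) : 'rV[R]_(d M) :=
  forward (finetuned_layer w) x M.

(* Output of the network when the output of layer m is set equal to u: layer m
   is replaced by the constant map u, all the other layers are unchanged. *)
Definition output_with_repr (M : nat) (w : forall j, 'rV[R]_(p j))
    (x : 'rV[R]_(d 0%N)) (m : nat) (u : 'rV[R]_(d m.+1)) : 'rV[R]_(d M) :=
  forward
    (dfwith (T := fun j => 'rV[R]_(d j) -> 'rV[R]_(d j.+1))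
       (finetuned_layer w) m (fun _ : 'rV[R]_(d m) => u))
    x M.

Definition grad_repr (M : nat) (loss : 'rV[R]_(d M) -> R)
    (w : forall j, 'rV[R]_(p j)) (x : 'rV[R]_(d 0%N)) (m : nat)
    : 'rV[R]_(d m.+1) :=
  gradient (fun u : 'rV[R]_(d m.+1) => loss (output_with_repr M w x u))
    (base_repr w x m + delta_repr w x m).

(* xm and target are separate arguments, so they do not vary with wm. *)
Definition aux_loss (m : nat) (xm : 'rV[R]_(d m)) (target : 'rV[R]_(d m.+1))
    (wm : 'rV[R]_(p m)) : R :=
  2^-1 * norm2 (g wm xm - target) ^+ 2.

End Network.

(* Main.v *)
(* Since [x_m] does not depend on [w_m], the network loss as a function of [w_m]
   is [Phi_m] composed with [w |-> h_m + g w x_m], while the auxiliary loss is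
   [u |-> |u - target|^2 / 2] composed with [w |-> g w x_m].  The two inner maps
   have the same derivative, and at [w_m^t] the two outer gradients agree: that
   of the quadratic is [Delta h_m - target], which is [grad Phi_m] by the choice
   of the target. *)
Require Import Defs.
From mathcomp Require Import all_boot all_order all_algebra.
From mathcomp Require Import all_classical all_reals all_analysis.

Import Order.TTheory GRing.Theory Num.Theory.
Import numFieldNormedType.Exports.

Local Open Scope ring_scope.

Section Gradient.
Context {R : realType}.

Lemma is_derive_coord {n} (a v : 'rV[R]_n) (i : 'I_n) :
  is_derive a v (fun z : 'rV[R]_n => z 0 i) (v 0 i).
Proof.
apply: DeriveDef; first exact/diff_derivable/differentiable_coord.
(* The derivative of the identity along [v] is [v] itself, and it is also the matrix of the
   derivatives of the coordinates. Only the right-hand [v] of the goal is then replaced. *)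
have := @derive_mx R _ 1 n id a v (@derivable_id _ _ a v).
by rewrite derive_id => {2}->; rewrite mxE.
Qed.

Lemma derive_gradient {n} (F : 'rV[R]_n -> R) (a v : 'rV[R]_n) :
  differentiable F a -> 'D_v F a = \sum_(i < n) v 0 i * gradient F a 0 i.
Proof.
move=> dF; rewrite deriveE// [in LHS](row_sum_delta v) linear_sum.
by apply: eq_bigr => i _; rewrite linearZ mxE deriveE.
Qed.

(** Chain rule in which the inner map enters only through its directional derivatives, so that inner
    maps differing by a constant give the same coefficients. *)
Lemma gradient_comp {k n} (F : 'rV[R]_n -> R) (G : 'rV[R]_k -> 'rV[R]_n)
    (a : 'rV[R]_k) :
  differentiable G a -> differentiable F (G a) ->
  gradient (F \o G) a =
  \row_(i < k) \sum_(j < n) ('D_(delta_mx 0 i) G a) 0 j * gradient F (G a) 0 j.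
Proof.
move=> dG dF; apply/rowP => i; rewrite !mxE.
rewrite (deriveE _ (differentiable_comp dG dF)) (diff_comp dG dF) /=.
by rewrite -(deriveE _ dG) -(deriveE _ dF) derive_gradient.
Qed.

Lemma derive_addl {k n} (c : 'rV[R]_n) (G : 'rV[R]_k -> 'rV[R]_n)
    (a v : 'rV[R]_k) :
  differentiable G a -> 'D_v (fun w => c + G w) a = 'D_v G a.
Proof.
move=> dG.
rewrite (deriveD (derivable_cst c a v) (diff_derivable dG)).
by rewrite derive_cst add0r.
Qed.

(** Squaring removes the root, which is not differentiable at 0. The right-hand side combines
    functions, not values, to fit the differentiation rules. *)
Lemma half_norm2_subE {n} (t : 'rV[R]_n) :
  (fun z => 2^-1 * norm2 (z - t) ^+ 2) =
  2^-1 \*: \sum_(i < n) ((fun z : 'rV[R]_n => z 0 i) - cst (t 0 i)) ^+ 2.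
Proof.
apply/funext => z; rewrite /norm2 sqr_sqrtr; last first.
  by apply: sumr_ge0 => i _; exact: sqr_ge0.
rewrite /= fct_sumE; congr (_ * _); apply: eq_bigr => i _.
by rewrite !mxE.
Qed.

Lemma differentiable_half_norm2_sub {n} (t a : 'rV[R]_n) :
  differentiable (fun z => 2^-1 * norm2 (z - t) ^+ 2) a.
Proof.
rewrite half_norm2_subE.
apply: differentiableZ; apply: differentiable_sum => i.
apply: differentiableX; apply: differentiableB; last exact: differentiable_cst.
exact: differentiable_coord.
Qed.

Lemma gradient_half_norm2_sub {n} (t a : 'rV[R]_n) :
  gradient (fun z => 2^-1 * norm2 (z - t) ^+ 2) a = a - t.
Proof.
apply/rowP => i; rewrite mxE half_norm2_subE.
(* Kept in the context so that instance resolution can differentiate the whole sum. Along the [i]-th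
   basis vector only the [i]-th square contributes. *)
have dcoord := is_derive_coord a (delta_mx 0 i).
rewrite derive_val scaler_sumr (bigD1 i)//= big1 => [|j ji].
  rewrite subr0 !mxE !eqxx expr1 addr0 !scalerA mulrA mulVf// mul1r.
  exact: mulr1.
by rewrite subr0 !mxE (negbTE ji) andbF !scaler0.
Qed.

End Gradient.

Section Forward.
Context {R : realType} {d : nat -> nat}.
Implicit Type step : forall j, 'rV[R]_(d j) -> 'rV[R]_(d j.+1).

(** Agreement is required only at the states actually visited, so a layer may be replaced by the
    constant map equal to its output there. *)
Lemma eq_forward step step' (x : 'rV[R]_(d 0%N)) k :
  (forall j, (j < k)%N ->
    step j (forward step x j) = step' j (forward step x j)) ->
  forward step x k = forward step' x k.
Proof.
elim: k => //= k IH e; rewrite e// IH// => j jk.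
by apply: e; exact: ltnW.
Qed.

(** By induction on [k]: just after layer [m] the state is [u] itself, and each later layer composes
    with a differentiable map. *)
Lemma differentiable_forward_dfwith step (x : 'rV[R]_(d 0%N)) m k
    (u : 'rV[R]_(d m.+1)) :
  (m < k)%N ->
  (forall j, (m < j < k)%N -> forall z, differentiable (step j) z) ->
  differentiable (fun u : 'rV[R]_(d m.+1) =>
    forward (dfwith step m (fun=> u)) x k) u.
Proof.
elim: k => // k IH; rewrite ltnS leq_eqVlt => /predU1P[<- _|mk dstep] /=.
  under eq_fun do rewrite dfwithin.
  exact: ex_diff.
under eq_fun do rewrite dfwithout ?(ltn_eqF mk)//.
apply: (differentiable_comp (IH mk _)) => [j /andP[mj jk]|].
  by apply: dstep; rewrite mj ltnW.
by apply: dstep; rewrite mk leqnn.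
Qed.

End Forward.

Theorem proposition1 (R : realType) (M : nat) (d p : nat -> nat)
  (Theta : nat -> Type) (Y : Type)
  (f : forall j : nat, Theta j -> 'rV[R]_(d j) -> 'rV[R]_(d j.+1))
  (theta : forall j : nat, Theta j)
  (g : forall j : nat, 'rV[R]_(p j) -> 'rV[R]_(d j) -> 'rV[R]_(d j.+1))
  (L : Y -> 'rV[R]_(d M) -> R)
  (hf : forall j : nat, (j < M)%N ->
     forall z : 'rV[R]_(d j), differentiable (f j (theta j)) z)
  (hg : forall j : nat, (j < M)%N ->
     forall wz : 'rV[R]_(p j) * 'rV[R]_(d j),
       differentiable
         (fun wz' : 'rV[R]_(p j) * 'rV[R]_(d j) => g j wz'.1 wz'.2) wz)
  (hL : forall (y : Y) (z : 'rV[R]_(d M)), differentiable (L y) z)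
  (x : 'rV[R]_(d 0%N)) (y : Y)
  (m : nat) (hm : (m < M)%N)
  (wt : forall j : nat, 'rV[R]_(p j)) :
  gradient
    (aux_loss g (hidden_input f theta g wt x m)
       (delta_repr f theta g wt x m - grad_repr f theta g (L y) wt x m))
    (wt m)
  = gradient
      (fun wm : 'rV[R]_(p m) =>
         L y (finetuned_output f theta g M
                (dfwith (T := fun j : nat => 'rV[R]_(p j)) wt m wm) x))
      (wt m).
Proof.
set xm := hidden_input f theta g wt x m.
pose G wm := g m wm xm; pose H wm := f m (theta m) xm + G wm.
pose Phi (u : 'rV[R]_(d m.+1)) := L y (output_with_repr f theta g M wt x u).
have dG : differentiable G (wt m).
  apply: (differentiable_comp (f := fun w => (w, xm))
    (g := fun wz => g m wz.1 wz.2)).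
    by apply: differentiable_pair; [exact: ex_diff|exact: differentiable_cst].
  exact: hg.
have dlayer j : (j < M)%N ->
    forall z, differentiable (finetuned_layer f theta g wt (j := j)) z.
  move=> jM z; apply: differentiableD; first exact: hf.
  apply: (differentiable_comp (f := fun z => (wt j, z))
    (g := fun wz => g j wz.1 wz.2)).
    by apply: differentiable_pair; [exact: differentiable_cst|exact: ex_diff].
  exact: hg.
have dPhi u : differentiable Phi u.
  apply: (differentiable_comp
    (f := output_with_repr f theta g M wt x (m := m)) (g := L y)); last exact: hL.
  apply: (differentiable_forward_dfwith _ _ _ _ _ hm) => j /andP[_].
  exact: dlayer.
have dH : differentiable H (wt m).
  by apply: differentiableD => //; exact: differentiable_cst.
have -> : (fun wm => L y (finetuned_output f theta g M
    (dfwith (T := fun j => 'rV[R]_(p j)) wt m wm) x)) = Phi \o H.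
  apply/funext => wm; rewrite /Phi /=; congr (L y _).
  set w := dfwith _ _ _.
  have wE : w m = wm by exact: dfwithin.
  have wjE j : m != j -> w j = wt j by exact: dfwithout.
  (* The layers before [m] do not see the changed parameter. *)
  have xmE : forward (finetuned_layer f theta g w) x m = xm.
    apply/esym/eq_forward => j jm.
    by rewrite /finetuned_layer wjE// (gtn_eqF jm).
  apply: eq_forward => j _; have [<-|mj] := eqVneq m j.
    by rewrite dfwithin xmE /finetuned_layer wE.
  by rewrite dfwithout// /finetuned_layer wjE.
rewrite (gradient_comp _ _ _ dH (dPhi _)).
(* By conversion, [aux_loss] is half the squared distance to the target composed with [G]. *)
rewrite (gradient_comp _ _ _ dG (differentiable_half_norm2_sub _ _)).
apply/rowP => i; rewrite !mxE; apply: eq_bigr => j _.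
(* By conversion, [G (wt m)] is the [delta_repr] inside the target and [H (wt m)] is the point where
   [grad_repr] is taken. *)
by rewrite (derive_addl _ _ _ _ dG) gradient_half_norm2_sub opprB addrC subrK.
Qed.
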